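(* Let $\mathcal K$ be a locally presentable abelian category and $(\mathcal F,\mathcal C)$ a complete cotorsion theory in $\mathcal K$ such that $\mathcal F$ is strongly closed under directed colimits in $\mathcal K$. Then $\mathcal C$ is stably weakly reflective in $\mathcal K$, that is, every object of $\mathcal K$ has a $\mathcal C$-envelope.
   Context: For a class $\mathcal A$ of objects of an abelian category $\mathcal K$, $\mathcal A^\perp$ is the class of all objects $B$ with $\operatorname{Ext}^1_{\mathcal K}(A,B)=0$ for all $A\in\mathcal A$, and ${}^\perp\mathcal A$ is the class of all objects $B$ with $\operatorname{Ext}^1_{\mathcal K}(B,A)=0$ for all $A\in\mathcal A$ (Yoneda $\operatorname{Ext}$). A cotorsion theory is a pair of classes of objects $(\mathcal F,\mathcal C)$ with $\mathcal C=\mathcal F^\perp$ and $\mathcal F={}^\perp\mathcal C$. It is complete if every object $K$ has a special $\mathcal F$-precover, i.e. an epimorphism $F\to K$ with $F\in\mathcal F$ and kernel in $\mathcal C$, and a special $\mathcal C$-preenvelope, i.e. a monomorphism $K\to C$ with $C\in\mathcal C$ and cokernel in $\mathcal F$. An $\mathcal F$-monomorphism is a monomorphism in $\mathcal K$ whose cokernel belongs to $\mathcal F$. The class $\mathcal F$ is strongly closed under directed colimits in $\mathcal K$ if, for every object $K\in\mathcal K$, the class of all $\mathcal F$-monomorphisms $K\to X$ is closed under directed colimits in the comma-category $K\downarrow\mathcal K$ (whose objects are the morphisms $K\to X$ in $\mathcal K$). A $\mathcal C$-envelope (stable weak reflection) of $K$ is a morphism $c:K\to C$ with $C\in\mathcal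 C$ such that every morphism $K\to C'$ with $C'\in\mathcal C$ factorizes (not necessarily uniquely) through $c$, and any morphism $h:C\to C$ with $hc=c$ is an isomorphism. A category is locally presentable if it is cocomplete and, for some regular cardinal $\lambda$, there is a set of $\lambda$-presentable objects such that every object is a $\lambda$-filtered colimit of objects from this set. *)

(* Defs.v *)
From mathcomp Require Import all_boot.
From mathcomp Require Import boolp classical_sets cardinality.
From Stdlib Require Relation_Definitions.

Set Implicit Arguments.
Unset Strict Implicit.
Unset Printing Implicit Defensive.

Local Open Scope classical_set_scope.

Declare Scope cat_scope.
Delimit Scope cat_scope with cat.
Local Open Scope cat_scope.

Reserved Notation "A ~> B" (at level 70, no associativity).
Reserved Notation "g \oc f" (at level 50, left associativity).

(* A fixed universe playing the role of the universe of sets: "small" means   *)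
(* "living in [small_type]".  Objects of a category live in a larger universe.*)
Definition small_type := Type.

Record isCategory (O : Type) := IsCategory {
  hom_of : O -> O -> small_type;
  idc_of : forall A, hom_of A A;
  comp_of : forall A B C, hom_of B C -> hom_of A B -> hom_of A C;
  comp1c_of : forall A B (f : hom_of A B), comp_of (idc_of B) f = f;
  compc1_of : forall A B (f : hom_of A B), comp_of f (idc_of A) = f;
  compcA_of : forall A B C D
    (h : hom_of C D) (g : hom_of B C) (f : hom_of A B),
    comp_of h (comp_of g f) = comp_of (comp_of h g) f }.

Record category := Category {
  ob :> Type;
  cat_class : isCategory ob }.

Record small_category := SmallCategory {
  small_ob : small_type;
  small_class : isCategory small_ob }.

Definition large (J : small_category) : category := Category (small_class J).
Coercion large : small_category >-> category.

Definition hom (K : category) (A B : K) : small_type :=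
  hom_of (cat_class K) A B.
Definition idc (K : category) (A : K) : hom A A := idc_of (cat_class K) A.
Definition comp (K : category) (A B C : K) (g : hom B C) (f : hom A B) :
  hom A C := comp_of g f.

Notation "A ~> B" := (hom A B) : cat_scope.
Notation "g \oc f" := (comp g f) : cat_scope.

Lemma comp1c (K : category) (A B : K) (f : A ~> B) : idc B \oc f = f.
Proof. exact: comp1c_of. Qed.

Lemma compc1 (K : category) (A B : K) (f : A ~> B) : f \oc idc A = f.
Proof. exact: compc1_of. Qed.

Lemma compcA (K : category) (A B C D : K)
    (h : C ~> D) (g : B ~> C) (f : A ~> B) :
  h \oc (g \oc f) = h \oc g \oc f.
Proof. exact: compcA_of. Qed.

Record functor (C D : category) := Functor {
  fob :> C -> D;
  fmap : forall A B : C, (A ~> B) -> (fob A ~> fob B);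
  fmap1 : forall A : C, fmap (idc A) = idc (fob A);
  fmapM : forall (A B B' : C) (g : B ~> B') (f : A ~> B),
    fmap (g \oc f) = fmap g \oc fmap f }.

Section FunctorComp.
Variables (C D E : category) (G : functor D E) (F : functor C D).

Lemma fcomp1 (A : C) : fmap G (fmap F (idc A)) = idc (G (F A)).
Proof. by rewrite !fmap1. Qed.

Lemma fcompM (A B B' : C) (g : B ~> B') (f : A ~> B) :
  fmap G (fmap F (g \oc f)) = fmap G (fmap F g) \oc fmap G (fmap F f).
Proof. by rewrite !fmapM. Qed.

Definition fcomp : functor C E := Functor fcomp1 fcompM.

End FunctorComp.

Record cocone (J C : category) (D : functor J C) (X : C) := Cocone {
  leg : forall j : J, D j ~> X;
  leg_natural : forall (i j : J) (u : i ~> j), leg j \oc fmap D u = leg i }.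

Definition is_colimit (J C : category) (D : functor J C) (X : C)
    (c : cocone D X) : Prop :=
  forall (Y : C) (d : cocone D Y),
    exists! h : X ~> Y, forall j : J, h \oc leg c j = leg d j.

Section MapCocone.
Variables (J C E : category) (F : functor C E) (D : functor J C) (X : C).
Variable c : cocone D X.

Lemma map_leg_natural (i j : J) (u : i ~> j) :
  fmap F (leg c j) \oc fmap (fcomp F D) u = fmap F (leg c i).
Proof. by rewrite /= -fmapM leg_natural. Qed.

Definition map_cocone : cocone (fcomp F D) (F X) :=
  @Cocone _ _ (fcomp F D) (F X) (fun j => fmap F (leg c j)) map_leg_natural.

End MapCocone.

Definition preserves_colimits_of (J C E : category) (F : functor C E)
    (D : functor J C) : Prop :=
  forall (X : C) (c : cocone D X), is_colimit c -> is_colimit (map_cocone F c).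

Definition cocomplete (K : category) : Prop :=
  forall (J : small_category) (D : functor J K),
    exists (X : K) (c : cocone D X), is_colimit c.

Definition SET : category := @Category small_type
  (@IsCategory small_type (fun A B => A -> B) (fun A x => x)
    (fun A B C g f x => g (f x))
    (fun A B f => erefl) (fun A B f => erefl) (fun A B C D h g f => erefl)).

Section HomFunctor.
Variables (K : category) (A : K).

Definition hom_ob (X : K) : SET := A ~> X.

Definition hom_map (X Y : K) (g : X ~> Y) : hom_ob X ~> hom_ob Y :=
  fun f : A ~> X => g \oc f.

Lemma hom_map1 (X : K) : hom_map (idc X) = idc (hom_ob X).
Proof. by apply: funext => f; apply: comp1c. Qed.

Lemma hom_mapM (X Y Z : K) (h : Y ~> Z) (g : X ~> Y) :
  hom_map (h \oc g) = hom_map h \oc hom_map g.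
Proof. by apply: funext => f; rewrite /hom_map -compcA. Qed.

Definition hom_functor : functor K SET := Functor hom_map1 hom_mapM.

End HomFunctor.

(* Below, a cardinal lam is represented by a small type of that cardinality.  *)

Definition card_lt (T U : Type) : Prop :=
  ([set: T] #<= [set: U])%card /\ ~ ([set: U] #<= [set: T])%card.

(* An infinite cardinal that is not a sum of fewer smaller cardinals. *)
Definition regular_cardinal (lam : small_type) : Prop :=
  infinite_set [set: lam] /\
  forall (I : small_type) (T : I -> small_type),
    card_lt I lam -> (forall i, card_lt (T i) lam) -> card_lt {i : I & T i} lam.

Definition morphisms (J : small_category) : small_type :=
  {a : small_ob J & {b : small_ob J & hom_of (small_class J) a b}}.

Definition filtered (lam : small_type) (J : small_category) : Prop :=
  forall (S : small_category) (D : functor S J),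
    card_lt (morphisms S) lam -> exists j : J, inhabited (cocone D j).

Definition presentable (K : category) (lam : small_type) (A : K) : Prop :=
  forall (J : small_category) (D : functor J K),
    filtered lam J -> preserves_colimits_of (hom_functor A) D.

Definition locally_presentable (K : category) : Prop :=
  cocomplete K /\
  exists lam : small_type, regular_cardinal lam /\
  exists (I : small_type) (G : I -> K),
    (forall i, presentable lam (G i)) /\
    forall X : K, exists (J : small_category) (D : functor J K)
      (c : cocone D X),
      [/\ filtered lam J, is_colimit c & forall j : J, exists i : I, D j = G i].

Record directed_poset := DirectedPoset {
  dcar : small_type;
  dle : dcar -> dcar -> Prop;
  dle_order : Relation_Definitions.order dcar dle;
  dinhabited : inhabited dcar;
  dle_directed : forall x y, exists z, dle x z /\ dle y z }.

Definition directed_category (P : directed_poset) : small_category :=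
  @SmallCategory (dcar P) (@IsCategory (dcar P) (fun x y => dle x y)
    (Relation_Definitions.ord_refl _ _ (dle_order P))
    (fun x y z yz xy =>
       Relation_Definitions.ord_trans _ _ (dle_order P) x y z xy yz)
    (fun _ _ _ => Prop_irrelevance _ _) (fun _ _ _ => Prop_irrelevance _ _)
    (fun _ _ _ _ _ _ _ => Prop_irrelevance _ _)).

Definition closed_under_directed_colimits (C : category) (S : set C) : Prop :=
  forall (P : directed_poset) (D : functor (directed_category P) C) (X : C)
    (c : cocone D X),
    is_colimit c -> (forall p : directed_category P, S (D p)) -> S X.

Section Under.
Variables (K : category) (A : K).

Record under_ob := Under { under_cod : K; under_map : A ~> under_cod }.

Definition under_hom (U V : under_ob) : small_type :=
  {h : under_cod U ~> under_cod V | h \oc under_map U = under_map V}.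

Definition under_id (U : under_ob) : under_hom U U :=
  exist _ (idc (under_cod U)) (comp1c (under_map U)).

Lemma under_comp_subproof (U V W : under_ob)
    (g : under_hom V W) (f : under_hom U V) :
  (sval g \oc sval f) \oc under_map U = under_map W.
Proof. by rewrite -compcA (svalP f) (svalP g). Qed.

Definition under_comp (U V W : under_ob)
    (g : under_hom V W) (f : under_hom U V) : under_hom U W :=
  exist _ (sval g \oc sval f) (under_comp_subproof g f).

Lemma under_hom_inj (U V : under_ob) (f g : under_hom U V) :
  sval f = sval g -> f = g.
Proof.
case: f g => [f pf] [g pg] /= fg; case: _ / fg in pg *.
by rewrite (Prop_irrelevance pf pg).
Qed.

Lemma under_comp1c (U V : under_ob) (f : under_hom U V) :
  under_comp (under_id V) f = f.
Proof. by apply: under_hom_inj; apply: comp1c. Qed.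

Lemma under_compc1 (U V : under_ob) (f : under_hom U V) :
  under_comp f (under_id U) = f.
Proof. by apply: under_hom_inj; apply: compc1. Qed.

Lemma under_compcA (U V W X : under_ob)
    (h : under_hom W X) (g : under_hom V W) (f : under_hom U V) :
  under_comp h (under_comp g f) = under_comp (under_comp h g) f.
Proof. by apply: under_hom_inj; apply: compcA. Qed.

Definition under : category :=
  Category (IsCategory under_comp1c under_compc1 under_compcA).

End Under.

Definition mono (K : category) (A B : K) (m : A ~> B) : Prop :=
  forall (X : K) (f g : X ~> A), m \oc f = m \oc g -> f = g.

Definition epi (K : category) (A B : K) (e : A ~> B) : Prop :=
  forall (X : K) (f g : B ~> X), f \oc e = g \oc e -> f = g.

Definition iso (K : category) (A B : K) (f : A ~> B) : Prop :=
  exists g : B ~> A, g \oc f = idc A /\ f \oc g = idc B.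

Definition zero_object (K : category) (Z : K) : Prop :=
  forall X : K, (exists! f : X ~> Z, True) /\ (exists! f : Z ~> X, True).

Record isPreadditive (K : category) := IsPreadditive {
  hom0 : forall A B : K, A ~> B;
  homD : forall A B : K, (A ~> B) -> (A ~> B) -> (A ~> B);
  homN : forall A B : K, (A ~> B) -> (A ~> B);
  homDA : forall (A B : K) (f g h : A ~> B),
    homD f (homD g h) = homD (homD f g) h;
  homDC : forall (A B : K) (f g : A ~> B), homD f g = homD g f;
  hom0D : forall (A B : K) (f : A ~> B), homD (hom0 A B) f = f;
  homND : forall (A B : K) (f : A ~> B), homD (homN f) f = hom0 A B;
  compDl : forall (A B C : K) (g h : B ~> C) (f : A ~> B),
    homD g h \oc f = homD (g \oc f) (h \oc f);
  compDr : forall (A B C : K) (h : B ~> C) (f g : A ~> B),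
    h \oc homD f g = homD (h \oc f) (h \oc g) }.

Section Preadditive.
Variables (K : category) (add : isPreadditive K).

Definition is_biproduct (A B P : K) (i1 : A ~> P) (i2 : B ~> P)
    (p1 : P ~> A) (p2 : P ~> B) : Prop :=
  [/\ p1 \oc i1 = idc A, p2 \oc i2 = idc B,
      p1 \oc i2 = hom0 add B A, p2 \oc i1 = hom0 add A B &
      homD add (i1 \oc p1) (i2 \oc p2) = idc P].

Definition is_kernel (A B N : K) (f : A ~> B) (k : N ~> A) : Prop :=
  f \oc k = hom0 add N B /\
  forall (X : K) (g : X ~> A), f \oc g = hom0 add X B ->
    exists! h : X ~> N, k \oc h = g.

Definition is_cokernel (A B Q : K) (f : A ~> B) (q : B ~> Q) : Prop :=
  q \oc f = hom0 add A Q /\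
  forall (X : K) (g : B ~> X), g \oc f = hom0 add A X ->
    exists! h : Q ~> X, h \oc q = g.

End Preadditive.

Record isAbelian (K : category) := IsAbelian {
  preadditive_of :> isPreadditive K;
  abelian_zero : exists Z : K, zero_object Z;
  abelian_biproduct : forall A B : K,
    exists (P : K) (i1 : A ~> P) (i2 : B ~> P) (p1 : P ~> A) (p2 : P ~> B),
      is_biproduct preadditive_of i1 i2 p1 p2;
  abelian_kernel : forall (A B : K) (f : A ~> B),
    exists (N : K) (k : N ~> A), is_kernel preadditive_of f k;
  abelian_cokernel : forall (A B : K) (f : A ~> B),
    exists (Q : K) (q : B ~> Q), is_cokernel preadditive_of f q;
  abelian_mono : forall (A B : K) (m : A ~> B), mono m ->
    exists (C : K) (f : B ~> C), is_kernel preadditive_of f m;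
  abelian_epi : forall (A B : K) (e : A ~> B), epi e ->
    exists (C : K) (f : C ~> A), is_cokernel preadditive_of f e }.

Section Cotorsion.
Variables (K : category) (ab : isAbelian K).

(* Short exact sequences 0 -> B -> E -> A -> 0. *)
Record extension (A B : K) := Extension {
  ext_mid : K;
  ext_in : B ~> ext_mid;
  ext_out : ext_mid ~> A;
  ext_kernel : is_kernel ab ext_out ext_in;
  ext_cokernel : is_cokernel ab ext_in ext_out }.

Definition ext_equiv (A B : K) (E E' : extension A B) : Prop :=
  exists h : ext_mid E ~> ext_mid E',
    [/\ iso h, h \oc ext_in E = ext_in E' & ext_out E' \oc h = ext_out E].

Definition ext_class (A B : K) (E : extension A B) : set (extension A B) :=
  [set E' | ext_equiv E E'].

Definition Ext1 (A B : K) : set (set (extension A B)) := range (@ext_class A B).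
Arguments Ext1 A B : clear implicits.

(* E is 0 -> B -> B (+) A -> A -> 0 with canonical injection and projection. *)
Definition direct_sum_extension (A B : K) (E : extension A B) : Prop :=
  exists (p1 : ext_mid E ~> B) (i2 : A ~> ext_mid E),
    is_biproduct ab (ext_in E) i2 p1 (ext_out E).

(* The zero element of the group Ext^1(A,B): the class of the direct sum. *)
Definition Ext1_zero (A B : K) : set (extension A B) :=
  [set E | exists2 E0, direct_sum_extension E0 & ext_equiv E0 E].
Arguments Ext1_zero A B : clear implicits.

Definition Ext1_vanishes (A B : K) : Prop := Ext1 A B = [set Ext1_zero A B].

Definition right_perp (F : set K) : set K :=
  [set B | forall A, F A -> Ext1_vanishes A B].

Definition left_perp (C : set K) : set K :=
  [set B | forall A, C A -> Ext1_vanishes B A].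

Definition cotorsion_theory (F C : set K) : Prop :=
  C = right_perp F /\ F = left_perp C.

Definition special_precover (F C : set K) (X Y : K) (f : Y ~> X) : Prop :=
  [/\ F Y, epi f & exists (N : K) (k : N ~> Y), is_kernel ab f k /\ C N].

Definition special_preenvelope (F C : set K) (X Y : K) (f : X ~> Y) : Prop :=
  [/\ C Y, mono f & exists (Q : K) (q : Y ~> Q), is_cokernel ab f q /\ F Q].

Definition complete_cotorsion_theory (F C : set K) : Prop :=
  [/\ cotorsion_theory F C,
      forall X : K, exists (Y : K) (f : Y ~> X), special_precover F C f &
      forall X : K, exists (Y : K) (f : X ~> Y), special_preenvelope F C f].

Definition F_mono (F : set K) (X Y : K) (m : X ~> Y) : Prop :=
  mono m /\ exists (Q : K) (q : Y ~> Q), is_cokernel ab m q /\ F Q.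

Definition strongly_closed_under_directed_colimits (F : set K) : Prop :=
  forall X : K, @closed_under_directed_colimits (under X)
    [set U : under_ob X | F_mono F (under_map U)].

End Cotorsion.

Arguments Ext1 {K} ab A B.
Arguments Ext1_zero {K} ab A B.

Definition is_envelope (K : category) (C : set K) (X Y : K) (c : X ~> Y) :
    Prop :=
  [/\ C Y,
      forall (Y' : K) (f : X ~> Y'), C Y' -> exists g : Y ~> Y', g \oc c = f &
      forall h : Y ~> Y, h \oc c = c -> iso h].

Definition stably_weakly_reflective (K : category) (C : set K) : Prop :=
  forall X : K, exists (Y : K) (c : X ~> Y), is_envelope C c.

(* Main.v *)
Require Import Defs.
From mathcomp Require Import all_boot.
From mathcomp Require Import boolp classical_sets.
From mathcomp Require wochoice.
From Stdlib Require Relation_Definitions.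

Set Implicit Arguments.
Unset Strict Implicit.
Unset Printing Implicit Defensive.

(** Let [c : X ~> Y] be a special [C]-preenvelope, seen as an object [t] of the
    category under [X].  Since [C] is the right perpendicular class of [F],
    every [F]-monomorphism under [X] maps to [t].  A directed system of
    endomorphisms of [t] has a colimit under [X], which is again an
    [F]-monomorphism by strong closure; composing the colimit cocone with a map
    from the colimit to [t] gives a cocone with vertex [t]
    ([special_preenvelope_directed_cocones]).

    The rest of the argument is about the monoid [End t], in which every small
    directed system has a cocone.  Call [m] stable if for every [a] there is
    [b] with [b a m = m]; equivalently, [m] generates a minimal left ideal.
    Transfinite chains of endomorphisms indexed by a well-order that is too
    large to inject into [End t] have repetitions, and repetitions give what is
    needed.
    - If no [m] were stable, one could build a chain whose composites from the
      first index generate strictly decreasing left ideals, hence are pairwise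
      distinct ([stable_exists]).
    - Let [s] be stable and take a chain all of whose maps [d i j] have the
      form [s m].  All of them are stable.  A cocone [N] on the whole chain has
      [N i = N j] for some [i < j], that is, [N j \oc e = N j] with
      [e = d i j].  Stability of [e] gives [b] with [b N_j e = e], so
      [b N_j = e] and [e e = b N_j e = e].
    Hence there is a stable idempotent [e] ([stable_idempotent]).

    Split [e] as [Y -b-> Z -a-> Y].  Then [Z] is a retract of [Y], so it lies in
    [C], and [b c : X ~> Z] is a weak reflection because [c] is one and
    [e c = c].  Stability of [e] says that every endomorphism of [Z] under [X]
    has a left inverse under [X]; so all of them are isomorphisms, and [b c] is
    an envelope. *)

Local Open Scope classical_set_scope.
Local Open Scope cat_scope.

(** * Stable idempotents among endomorphisms *)

(** A directed system all of whose objects are [t] is a family [d] of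
    endomorphisms; the cocones are required to have vertex [t] as well, so that
    the condition is one on the monoid of endomorphisms of [t]. *)
Definition directed_cocones (G : category) (t : G) : Prop :=
  forall (P : directed_poset) (d : dcar P -> dcar P -> (t ~> t)),
    (forall p, d p p = idc t) ->
    (forall p q r, dle p q -> dle q r -> d q r \oc d p q = d p r) ->
    exists n : dcar P -> (t ~> t), forall p q, dle p q -> n q \oc d p q = n p.

Definition stable (G : category) (t : G) (m : t ~> t) : Prop :=
  forall a : t ~> t, exists b : t ~> t, b \oc a \oc m = m.

(** Cantor's diagonal argument.  Subsets are plain predicates so that they form a
    type in the universe of [T]: they will index a small diagram. *)
Lemma cantor_no_injection (T : Type) (f : (T -> Prop) -> T) : ~ injective f.
Proof.
move=> f_inj; pose D x := exists2 A, f A = x & ~ A x.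
have [DfD|nDfD] := pselect (D (f D)); last by apply: (nDfD); exists D.
by case: (DfD) => A /f_inj -> nDf.
Qed.

Section TransfiniteChains.

Variables (G : category) (t : G) (W : small_type) (R : rel W).
Hypothesis R_wo : wochoice.well_order R.

Let lt (i j : W) : Prop := R i j /\ i <> j.

Let R_min (A : set W) : A !=set0 ->
  exists2 m, A m /\ (forall x, A x -> R m x) &
    forall m', A m' -> (forall x, A x -> R m' x) -> m = m'.
Proof.
case=> x Ax; have [|m [[mA mmin] muniq]] := R_wo (A := [pred z | `[< A z >]]).
  by exists x; apply/asboolP.
exists m => [|m' Am' m'min]; last first.
  by apply: muniq; split=> [|y /asboolP]; [apply/asboolP | exact: m'min].
by split=> [|y Ay]; [apply/asboolP | apply: mmin; apply/asboolP].
Qed.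

Let R_total : total R.
Proof.
move=> x y; have [|m [[->|->] mmin] _] := R_min (A := [set x; y]).
- by exists x; left.
- by rewrite mmin //; right.
- by rewrite orbC mmin //; left.
Qed.

Let R_refl : reflexive R.
Proof. by move=> x; have := R_total x x; rewrite orbb. Qed.

Let R_anti : antisymmetric R.
Proof.
move=> x y /andP[xy yx]; have [|m _ muniq] := R_min (A := [set x; y]).
  by exists x; left.
by rewrite -(muniq x) ?(muniq y) //; try (by left); try (by right);
  move=> z [->|->].
Qed.

Let R_trans : transitive R.
Proof.
move=> y x z xy yz.
have [|m [[->|->|->] mmin] _] :=
    R_min (A := [set w | [\/ w = x, w = y | w = z]]).
- by exists x; constructor 1.
- by apply: mmin; constructor 3.
- suff -> : x = y by [].
  by apply: R_anti; rewrite xy mmin //; constructor 1.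
- suff -> : z = y by [].
  by apply: R_anti; rewrite yz mmin //; constructor 2.
Qed.

Let lt_trans i j k : lt i j -> lt j k -> lt i k.
Proof.
move=> [ij nij] [jk njk]; split; first exact: R_trans jk.
by move=> ik; apply: nij; apply: R_anti; rewrite ij ik jk.
Qed.

Let lt_total i j : [\/ i = j, lt i j | lt j i].
Proof.
have [->|nij] := pselect (i = j); first by constructor 1.
have /orP[ij|ji] := R_total i j; first by constructor 2.
by constructor 3; split=> // /esym.
Qed.

Let lt_wf : well_founded lt.
Proof.
move=> x; apply: contrapT => nAx.
have [|m [nAm mmin] _] := R_min (A := [set w | ~ Acc lt w]).
  by exists x.
apply: nAm; constructor=> y [ym nym]; apply: contrapT => nAy.
by apply: nym; apply: R_anti; rewrite ym mmin.
Qed.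

(** Chains are described by their maps [d i j] for [i < j] alone: the
    transfinite construction below then never has to treat the identities [d i i]. *)
Definition strict_system (A : set W) (d : W -> W -> (t ~> t)) : Prop :=
  forall i j k, A i -> A j -> A k -> lt i j -> lt j k ->
    d j k \oc d i j = d i k.

Definition strict_cocone (A : set W) (d : W -> W -> (t ~> t))
    (n : W -> (t ~> t)) : Prop :=
  forall i j, A i -> A j -> lt i j -> n j \oc d i j = n i.

Hypothesis cocones : directed_cocones t.

(** The subset [A] with the identities added is a directed system, unless [A] is
    empty, in which case every family is a cocone. *)
Lemma strict_cocone_exists (A : set W) (d : W -> W -> (t ~> t)) :
  strict_system A d -> exists n, strict_cocone A d n.
Proof.
move=> dsys; have [[a0 Aa0]|A0] := pselect (A !=set0); last first.
  by exists (fun=> idc t) => i j Ai; case: A0; exists i.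
pose le (x y : {i | A i}) : Prop := R (sval x) (sval y).
have leo : Relation_Definitions.order _ le.
  split=> [x|x y z xy yz|[x Ax] [y Ay]]; rewrite /le.
  - exact: R_refl.
  - exact: R_trans yz.
  - move=> /= xy yx; have xEy : x = y by apply: R_anti; rewrite xy yx.
    by case: _ / xEy in Ay xy yx *; congr exist; apply: Prop_irrelevance.
have ledir x y : exists z, le x z /\ le y z.
  by have /orP[xy|yx] := R_total (sval x) (sval y);
    [exists y|exists x]; split=> //; apply: R_refl.
pose P := DirectedPoset leo (inhabits (exist A a0 Aa0)) ledir.
pose d' (x y : dcar P) :=
  if `[< sval x = sval y >] then idc t else d (sval x) (sval y).
have [|[p Ap] [q Aq] [r Ar] /=|n nE] := cocones (P := P) (d := d').
- by move=> p; rewrite /d' asboolT.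
- rewrite /d' /= => pq qr.
  case: (pselect (p = q)) => [->|npq].
    by rewrite (asboolT (erefl q)) compc1.
  case: (pselect (q = r)) => [<-|nqr].
    by rewrite (asboolT (erefl q)) comp1c.
  have [_ npr] : lt p r by apply: (@lt_trans _ q).
  by rewrite !asboolF //; apply: dsys.
- exists (fun i => if pselect (A i) is left Ai then n (exist A i Ai) else idc t).
  move=> i j Ai Aj [ij nij]; case: pselect => // Aj'; case: pselect => // Ai'.
  have := nE (exist A i Ai') (exist A j Aj') ij.
  by rewrite /d' /= asboolF.
Qed.

(** A fixed choice of cocones makes the chains below definable by well-founded
    recursion; by the previous lemma the default value is never taken on a
    coherent system. *)
Definition choose_cocone (A : set W) (d : W -> W -> (t ~> t)) : W -> (t ~> t) :=
  if pselect (exists n, strict_cocone A d n) is left ex then sval (cid ex)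
  else fun=> idc t.

(** Transfinite iteration: at stage [j] choose a cocone [n j] on the chain built
    so far and follow it by a step [s (n j)], which may depend on the cocone.  The
    same rule serves at zero, successor and limit stages. *)
Lemma transfinite_chain (s : (W -> (t ~> t)) -> (t ~> t)) :
  exists (d : W -> W -> (t ~> t)) (n : W -> W -> (t ~> t)),
    [/\ strict_system setT d, forall j, strict_cocone [set i | lt i j] d (n j) &
        forall i j, lt i j -> d i j = s (n j) \oc n j i].
Proof.
(* [old j f] extends by identities the maps between indices below [j], so that
   the choice of a cocone applies to a function on all of [W]. *)
pose old j (f : forall k, lt k j -> W -> (t ~> t)) (i k : W) :=
  if pselect (lt k j) is left kj then f k kj i else idc t.
pose step j f i :=
  let n := choose_cocone [set i | lt i j] (old j f) in s n \oc n i.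
pose row := Fix lt_wf (fun=> W -> (t ~> t)) step.
pose d i j := row j i.
pose n j := choose_cocone [set i | lt i j] (old j (fun k _ => row k)).
have dE i j : d i j = s (n j) \oc n j i.
  rewrite /d /row Fix_eq // => x f g fg; congr step.
  by do 2![apply: functional_extensionality_dep => ?].
have oldE j i k : lt k j -> old j (fun k _ => row k) i k = d i k.
  by rewrite /old; case: pselect.
have nP j :
    strict_system [set i | lt i j] d -> strict_cocone [set i | lt i j] d (n j).
  move=> dsys i k ij kj ik; rewrite -(oldE j) // /n /choose_cocone.
  case: pselect => [ex|[]]; first by case: cid => m /= mP; apply: mP.
  apply: strict_cocone_exists => a b c aj bj cj ab bc.
  by rewrite !oldE //; apply: dsys.
have dsys j : strict_system [set i | lt i j] d.
  elim/(well_founded_ind lt_wf): j => j IHj a b c aj bj cj ab bc.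
  by rewrite (dE b c) (dE a c) -compcA (nP c (IHj c cj)) //; apply: lt_trans bc.
exists d, n; split=> // [a b c _ _ _ ab bc|j]; last exact: nP.
rewrite (dE b c) (dE a c) -compcA (nP c (dsys c)) //; exact: lt_trans bc.
Qed.

Hypothesis W_large : forall f : W -> option (t ~> t), ~ injective f.

(** Otherwise each [m] has some [a] such that [m] is not in the left ideal of
    [a m].  Stepping by such an [a] at every stage yields composites
    [d w0 j = a (n j w0) \oc n j w0] from the least index [w0]; if
    [d w0 i = d w0 j] with [i < j], then [n j i] brings [a m] back to
    [m = n j w0]. *)
Lemma stable_exists : exists m : t ~> t, stable m.
Proof.
apply: contrapT => nstable.
have /choice[a aP] : forall m : t ~> t, exists a : t ~> t,
    forall b, b \oc a \oc m <> m.
  move=> m; apply: contrapT => na; apply: nstable; exists m => a.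
  by apply: contrapT => nb; apply: na; exists a => b bE; apply: nb; exists b.
(* [f := fun=> None] is not injective, so the well-order is not empty. *)
have [w0 w0min] : exists w0, forall w, R w0 w.
  have [[w]|w0] := pselect (inhabited W); last first.
    by case: (W_large (f := fun=> None)) => w; case: w0; exists.
  have [|w0 [_ w0P] _] := R_min (A := setT); first by exists w.
  by exists w0 => v; apply: w0P.
have [d [n [dsys nP dE]]] := transfinite_chain (fun n => a (n w0)).
have d0_inj i j : lt i j -> lt w0 i -> d w0 i <> d w0 j.
  move=> ij w0i; have w0j := lt_trans w0i ij.
  rewrite (dE _ _ w0j) => dij; apply: (aP (n j w0) (n j i)).
  by rewrite -compcA -dij; apply: nP.
(* [d w0 w0] is meaningless, so [w0] is sent to the extra point [None]. *)
apply: (W_large (f := fun j =>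
  if `[< j = w0 >] then None else Some (d w0 j))) => i j.
have above k : k <> w0 -> lt w0 k by move=> nk; split=> // /esym.
case: asboolP => [->|/above w0i]; case: asboolP => [->|/above w0j] //.
move=> [dij].
by have [//|/d0_inj/(_ w0i)|/d0_inj/(_ w0j)] := lt_total i j; rewrite dij.
Qed.

(** With constant step [s] every [d i j] is [s] after something, hence stable.  If a
    cocone [N] satisfies [N i = N j] then [N j] absorbs [d i j] on the right,
    and stability puts [d i j] in the left ideal of [N j]; so [d i j] absorbs
    itself. *)
Lemma stable_idempotent_of_well_order :
  exists e : t ~> t, e \oc e = e /\ stable e.
Proof.
have [s s_stable] := stable_exists.
have [d [n [dsys nP dE]]] := transfinite_chain (fun=> s).
have [N NP] := strict_cocone_exists dsys.
have [i [j [ij Nij]]] : exists i j, lt i j /\ N i = N j.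
  apply: contrapT => nN; apply: (W_large (f := Some \o N)) => i j [Nij].
  case: (lt_total i j) => // ij; case: nN; first by exists i, j.
  by exists j, i.
have de_stable : stable (d i j).
  move=> a; have [b bE] := s_stable a; exists b.
  by rewrite (dE _ _ ij) compcA bE.
have Ne : N j \oc d i j = N j by rewrite NP.
exists (d i j); split=> //.
have [b] := de_stable (N j); rewrite -compcA Ne => bN.
by rewrite -{1}bN -compcA Ne.
Qed.

End TransfiniteChains.

Lemma stable_idempotent (G : category) (t : G) :
  directed_cocones t -> exists e : t ~> t, e \oc e = e /\ stable e.
Proof.
move=> cocones; pose W : small_type := option (t ~> t) -> Prop.
have [R R_wo] := wochoice.well_ordering_principle {eclassic W}.
exact: (@stable_idempotent_of_well_order G t W R R_wo cocones
  (@cantor_no_injection _)).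
Qed.
(** * Preadditive categories: kernels, cokernels and biproducts *)

Section PreadditiveTheory.
Variables (K : category) (ab : isPreadditive K).

Local Notation "0" := (hom0 ab _ _) : cat_scope.
Local Notation "f + g" := (homD ab f g) : cat_scope.
Local Notation "- f" := (homN ab f) : cat_scope.

Lemma homDN (A B : K) (f : A ~> B) : f + - f = 0.
Proof. by rewrite homDC homND. Qed.

Lemma homD0 (A B : K) (f : A ~> B) : f + 0 = f.
Proof. by rewrite homDC hom0D. Qed.

Lemma homD_cancel (A B : K) (f g h : A ~> B) : f + g = f + h -> g = h.
Proof.
by move=> fgh; rewrite -(hom0D ab g) -(homND ab f) -homDA fgh homDA homND hom0D.
Qed.

Lemma homN0 (A B : K) : - (0 : A ~> B) = 0.
Proof. by apply: (@homD_cancel _ _ 0); rewrite homDN homD0. Qed.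

Lemma comp0 (A B C : K) (g : B ~> C) : g \oc (0 : A ~> B) = 0.
Proof.
by apply: (@homD_cancel _ _ (g \oc 0)); rewrite -compDr hom0D homD0.
Qed.

Lemma comp0c (A B C : K) (f : A ~> B) : (0 : B ~> C) \oc f = 0.
Proof.
by apply: (@homD_cancel _ _ (0 \oc f)); rewrite -compDl hom0D homD0.
Qed.

Lemma compNr (A B C : K) (g : B ~> C) (f : A ~> B) : g \oc (- f) = - (g \oc f).
Proof.
by apply: (@homD_cancel _ _ (g \oc f)); rewrite -compDr !homDN comp0.
Qed.

Lemma compNl (A B C : K) (g : B ~> C) (f : A ~> B) : (- g) \oc f = - (g \oc f).
Proof.
by apply: (@homD_cancel _ _ (g \oc f)); rewrite -compDl !homDN comp0c.
Qed.

Lemma homD_eq0 (A B : K) (f g : A ~> B) : f + - g = 0 -> f = g.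
Proof.
move=> fg; apply: (@homD_cancel _ _ (- g)).
by rewrite homND homDC.
Qed.

Lemma mono_of_cancel0 (A B : K) (m : A ~> B) :
  (forall X (f : X ~> A), m \oc f = 0 -> f = 0) -> mono m.
Proof.
move=> m0 X f g mfg; apply: homD_eq0; apply: m0.
by rewrite compDr compNr mfg homDN.
Qed.

Lemma is_kernel_mono (A B N : K) (f : A ~> B) (k : N ~> A) :
  is_kernel ab f k -> mono k.
Proof.
move=> [fk kuniv]; apply: mono_of_cancel0 => X g kg.
have [|h [_ huniq]] := kuniv X 0; first exact: comp0.
by rewrite -(huniq g) // (huniq 0) // comp0.
Qed.

Lemma is_cokernel_epi (A B Q : K) (f : A ~> B) (q : B ~> Q) :
  is_cokernel ab f q -> epi q.
Proof.
move=> [qf quniv] X u v uv.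
have [|h [_ huniq]] := quniv X (u \oc q).
  by rewrite -compcA qf comp0.
by rewrite -(huniq u) // (huniq v).
Qed.

Lemma biproduct_kernel (A B P : K) (i1 : A ~> P) (i2 : B ~> P)
    (p1 : P ~> A) (p2 : P ~> B) :
  is_biproduct ab i1 i2 p1 p2 -> is_kernel ab p2 i1.
Proof.
case=> p1i1 p2i2 p1i2 p2i1 idP; split=> // X g p2g; exists (p1 \oc g); split.
  by rewrite -[RHS]comp1c -idP compDl -[i2 \oc p2 \oc g]compcA p2g comp0 homD0
    compcA.
by move=> h <-; rewrite compcA p1i1 comp1c.
Qed.

Lemma biproduct_cokernel (A B P : K) (i1 : A ~> P) (i2 : B ~> P)
    (p1 : P ~> A) (p2 : P ~> B) :
  is_biproduct ab i1 i2 p1 p2 -> is_cokernel ab i1 p2.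
Proof.
case=> p1i1 p2i2 p1i2 p2i1 idP; split=> // X g gi1; exists (g \oc i2); split.
  by rewrite -[RHS]compc1 -idP compDr !compcA gi1 comp0c hom0D.
by move=> h <-; rewrite -compcA p2i2 compc1.
Qed.

(** The complementary idempotent [1 - i r] kills [i], so it factors through the
    cokernel [q]; the factor is the section. *)
Lemma biproduct_of_retraction (A B P : K) (i : A ~> P) (q : P ~> B)
    (r : P ~> A) :
  is_kernel ab q i -> is_cokernel ab i q -> r \oc i = idc A ->
  exists s : B ~> P, is_biproduct ab i s r q.
Proof.
move=> ker_i [qi quniv] ri.
have [|s [sq _]] := quniv P (idc P + - (i \oc r)).
  by rewrite compDl compNl comp1c -compcA ri compc1 homDN.
have epi_q : epi q := is_cokernel_epi (conj qi quniv).
exists s; split=> //.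
- apply: epi_q; rewrite -compcA sq compDr compNr compcA qi comp0c compc1 comp1c.
  by rewrite homN0 homD0.
- apply: epi_q; rewrite -compcA sq compDr compNr compcA ri comp1c compc1.
  by rewrite homDN comp0c.
- by rewrite sq homDC -homDA homND homD0.
Qed.

Lemma biproduct_joint_epi (A B P : K) (i1 : A ~> P) (i2 : B ~> P)
    (p1 : P ~> A) (p2 : P ~> B) (X : K) (f g : P ~> X) :
  is_biproduct ab i1 i2 p1 p2 -> f \oc i1 = g \oc i1 -> f \oc i2 = g \oc i2 ->
  f = g.
Proof.
case=> _ _ _ _ idP f1 f2.
by rewrite -[f]compc1 -[g]compc1 -idP !compDr !compcA f1 f2.
Qed.

End PreadditiveTheory.
(** * Vanishing of Ext and extension of morphisms *)

Section ExtensionsAndSplitting.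
Variables (K : category) (ab : isAbelian K).

Lemma mono_is_kernel_of_cokernel (X Y Q : K) (m : X ~> Y) (q : Y ~> Q) :
  mono m -> is_cokernel ab m q -> is_kernel ab q m.
Proof.
move=> /(abelian_mono ab)[Z [f [fm funiv]]] [qm quniv]; split=> // V g qg.
have [f' [f'q _]] := quniv Z f fm.
by apply: funiv; rewrite -f'q -compcA qg comp0.
Qed.

Lemma ext_equiv_refl (A B : K) (E : extension ab A B) : ext_equiv E E.
Proof.
exists (idc (ext_mid E)); split; [|exact: comp1c|exact: compc1].
by exists (idc (ext_mid E)); rewrite comp1c.
Qed.

Lemma ext_equiv_sym (A B : K) (E E' : extension ab A B) :
  ext_equiv E E' -> ext_equiv E' E.
Proof.
case=> h [[g [gh hg]] h_in h_out]; exists g; split; first by exists h.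
- by rewrite -h_in compcA gh comp1c.
- by rewrite -h_out -compcA hg compc1.
Qed.

Lemma ext_equiv_trans (A B : K) (E E' E'' : extension ab A B) :
  ext_equiv E E' -> ext_equiv E' E'' -> ext_equiv E E''.
Proof.
case=> h [[g [gh hg]] h_in h_out] [h' [[g' [gh' hg']] h'_in h'_out]].
exists (h' \oc h); split.
- exists (g \oc g'); split.
  + by rewrite compcA -[g \oc g' \oc h']compcA gh' compc1.
  + by rewrite compcA -[h' \oc h \oc g]compcA hg compc1.
- by rewrite -compcA h_in.
- by rewrite compcA h'_out.
Qed.

Lemma direct_sum_extension_equiv (A B : K) (E E' : extension ab A B) :
  direct_sum_extension E -> direct_sum_extension E' -> ext_equiv E E'.
Proof.
case=> p [i biE] [p' [i' biE']].
have [pi qi' pi' qi idE] := biE; have [pi2 qi2' pi2' qi2 idE'] := biE'.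
pose h := homD ab (ext_in E' \oc p) (i' \oc ext_out E).
pose g := homD ab (ext_in E \oc p') (i \oc ext_out E').
have h_in : h \oc ext_in E = ext_in E'.
  by rewrite /h compDl -!compcA pi qi compc1 comp0 homD0.
have h_i : h \oc i = i' by rewrite /h compDl -!compcA pi' qi' compc1 comp0 hom0D.
have g_in : g \oc ext_in E' = ext_in E.
  by rewrite /g compDl -!compcA pi2 qi2 compc1 comp0 homD0.
have g_i : g \oc i' = i by rewrite /g compDl -!compcA pi2' qi2' compc1 comp0 hom0D.
exists h; split=> //.
  exists g; split.
  - by apply: (biproduct_joint_epi biE); rewrite comp1c -compcA ?h_in ?h_i.
  - by apply: (biproduct_joint_epi biE'); rewrite comp1c -compcA ?g_in ?g_i.
apply: (biproduct_joint_epi biE); rewrite -compcA.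
  by rewrite h_in qi2 qi.
by rewrite h_i qi2' qi'.
Qed.

(** Two split extensions are equivalent, so there is exactly one class of them; the
    direct sum shows that this class is inhabited. *)
Lemma Ext1_vanishesP (A B : K) :
  Ext1_vanishes ab A B <->
  forall E : extension ab A B,
    exists r : ext_mid E ~> B, r \oc ext_in E = idc B.
Proof.
split=> [vanE E|splitE].
  have : Ext1 ab A B (ext_class E) by exists E.
  rewrite vanE => /= classE.
  have : ext_class E E by exact: ext_equiv_refl.
  rewrite classE => -[E0 [p [i [pi _ _ _ _]]] [h [[g [gh _]] h_in _]]].
  by exists (p \oc g); rewrite -h_in compcA -[p \oc g \oc h]compcA gh compc1.
have sumE (E : extension ab A B) : direct_sum_extension E.
  have [r rE] := splitE E; exists r.
  exact: biproduct_of_retraction (ext_kernel E) (ext_cokernel E) rE.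
have class0 (E : extension ab A B) : ext_class E = Ext1_zero ab A B.
  apply/seteqP; split=> E' /= EE'; first by exists E.
  by case: EE' => E0 _ E0E'; apply: direct_sum_extension_equiv; apply: sumE.
have [P [i1 [i2 [p1 [p2 biP]]]]] := abelian_biproduct ab B A.
pose E := Extension (biproduct_kernel biP) (biproduct_cokernel biP).
apply/seteqP; split=> [_ [E' _ <-]|_ ->] /=; first exact: class0.
by exists E; rewrite ?class0.
Qed.

(** Push [m] out along [f]: the pushout [E] is the cokernel of
    [w = (m, -f) : X ~> Y (+) Z].  Then [Z ~> E] is again a monomorphism with
    cokernel [Q], so this is an extension of [Q] by [Z], and a retraction of
    [Z ~> E] composed with [Y ~> E] extends [f]. *)
Lemma extend_along_mono (X Y Q Z : K) (m : X ~> Y) (q : Y ~> Q) (f : X ~> Z) :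
  mono m -> is_cokernel ab m q -> Ext1_vanishes ab Q Z ->
  exists g : Y ~> Z, g \oc m = f.
Proof.
move=> mono_m coker_q /Ext1_vanishesP splitE; have [qm quniv] := coker_q.
have [P [i1 [i2 [p1 [p2 biP]]]]] := abelian_biproduct ab Y Z.
have [p1i1 p2i2 p1i2 p2i1 idP] := biP.
pose w := homD ab (i1 \oc m) (homN ab (i2 \oc f)).
have p1w : p1 \oc w = m.
  by rewrite compDr compNr !compcA p1i1 p1i2 comp1c comp0c homN0 homD0.
have mono_w : mono w.
  by move=> V u v /(congr1 (fun z => p1 \oc z)); rewrite !compcA p1w => /mono_m.
have [E [e coker_e]] := abelian_cokernel ab w.
have [we ekuniv] := mono_is_kernel_of_cokernel mono_w coker_e.
have [ew euniv] := coker_e.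
have square : e \oc i1 \oc m = e \oc i2 \oc f.
  by apply: (@homD_eq0 _ ab); rewrite -!compcA -compNr -compDr.
(* If [e i2 u = 0] then [i2 u] factors through the kernel [w] of [e]; the factor
   is zero because its image under [p1 w = m] is. *)
have mono_j : mono (e \oc i2).
  apply: (@mono_of_cancel0 _ ab) => V u ju.
  have [|v [wv _]] := ekuniv V (i2 \oc u); first by rewrite compcA.
  have v0 : v = hom0 ab V X.
    apply: mono_m; rewrite comp0 -p1w -compcA wv compcA p1i2 comp0c; done.
  by rewrite -[u]comp1c -p2i2 -compcA -wv v0 !comp0.
have [|r [re _]] := euniv Q (q \oc p1).
  by rewrite -compcA p1w.
have coker_r : is_cokernel ab (e \oc i2) r.
  split=> [|V g gj]; first by rewrite compcA re -compcA p1i2 comp0.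
  have [|h [hq huniq]] := quniv V (g \oc e \oc i1).
    by rewrite -compcA -compcA [e \oc _]compcA square !compcA
      -[g \oc e \oc i2]compcA
      gj comp0c.
  exists h; split=> [|h' h'r].
    apply: (is_cokernel_epi coker_e); apply: (biproduct_joint_epi biP).
      by rewrite -[h \oc r \oc e]compcA re -!compcA p1i1 compc1 hq -compcA.
    by rewrite -!compcA [r \oc _]compcA re -compcA p1i2 !comp0 gj.
  by apply: huniq; rewrite -h'r -!compcA [r \oc _]compcA re -compcA p1i1 compc1.
pose ext := Extension (mono_is_kernel_of_cokernel mono_j coker_r) coker_r.
have [s /= sj] := splitE ext.
exists (s \oc e \oc i1).
by rewrite -2!compcA [e \oc _]compcA square compcA sj comp1c.
Qed.

(** For an extension of [A] by [Y], extending [a] along the inclusion of [Y] and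
    then applying [b] gives a retraction. *)
Lemma right_perp_retract (F : set K) (X Y : K) (a : Y ~> X) (b : X ~> Y) :
  b \oc a = idc Y -> right_perp ab F X -> right_perp ab F Y.
Proof.
move=> ba perpX A FA; apply/Ext1_vanishesP => E.
have [g gE] := extend_along_mono a (is_kernel_mono (ext_kernel E))
  (ext_cokernel E) (perpX A FA).
by exists (b \oc g); rewrite -compcA gE.
Qed.

(** The image of [e] is the kernel of [1 - e]. *)
Lemma idempotent_splits (X : K) (e : X ~> X) : e \oc e = e ->
  exists (Y : K) (a : Y ~> X) (b : X ~> Y), a \oc b = e /\ b \oc a = idc Y.
Proof.
move=> ee; have [Y [a ker_a]] := abelian_kernel ab (homD ab (idc X) (homN ab e)).
have [ka kuniv] := ker_a.
have ea : e \oc a = a.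
  by apply/esym/(@homD_eq0 _ ab); rewrite -{1}[a]comp1c -compNl -compDl.
have [|b [ab_e _]] := kuniv X e.
  by rewrite compDl compNl comp1c ee homDN.
exists Y, a, b; split=> //; apply: (is_kernel_mono ker_a).
by rewrite compcA ab_e ea compc1.
Qed.

End ExtensionsAndSplitting.

(** * Directed colimits in the category under an object *)

Section UnderDirectedColimits.
Variables (K : category) (X : K) (P : directed_poset).
Variable D : functor (directed_category P) (under X).

Definition under_forget_functor : functor (directed_category P) K.
Proof.
exists (fun p => under_cod (D p)) (fun p q u => sval (fmap D u)).
- by move=> p; rewrite fmap1.
- by move=> p q r v u; rewrite fmapM.
Defined.

(** A directed poset is connected and nonempty, so the colimit of the codomains
    receives one well-defined map from [X], and this is the colimit under [X]. *)
Lemma under_directed_colimit_exists : cocomplete K ->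
  exists (U : under X) (c : cocone D U), is_colimit c.
Proof.
move=> /(_ _ under_forget_functor)[Y [c ccol]]; have [p0] := dinhabited P.
pose y p := leg c p \oc under_map (D p).
have y_le p q : dle p q -> y p = y q.
  move=> pq; rewrite /y -(leg_natural c (pq : hom (p : directed_category P) q)).
  by rewrite -compcA (svalP (fmap D _)).
have yE p : y p = y p0.
  by have [q [pq p0q]] := dle_directed p p0; rewrite (y_le p q) // (y_le p0 q).
pose U : under X := Under (y p0).
pose ulegs (p : directed_category P) : D p ~> U := exist _ (leg c p) (yE p).
have ulegs_nat (p q : directed_category P) (u : p ~> q) :
    ulegs q \oc fmap D u = ulegs p.
  by apply: under_hom_inj; apply: (leg_natural c u).
exists U, (Cocone ulegs_nat) => V d.
have dnat (p q : directed_category P) (u : p ~> q) :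
    sval (leg d q) \oc fmap under_forget_functor u = sval (leg d p).
  by rewrite -(leg_natural d u).
have [h [hE huniq]] := ccol _ (Cocone dnat).
have hU : h \oc under_map U = under_map V.
  by rewrite /= /y compcA hE (svalP (leg d p0)).
exists (exist _ h hU : U ~> V); split=> [p|g gE].
  by apply: under_hom_inj; apply: hE.
apply: under_hom_inj; apply: huniq => p /=.
by rewrite -(gE p).
Qed.

End UnderDirectedColimits.

(** * Envelopes *)

Section Envelopes.
Variables (K : category) (ab : isAbelian K) (F C : set K).
Hypothesis C_perp : C = right_perp ab F.

Lemma F_mono_extend (X Y Z : K) (m : X ~> Y) (f : X ~> Z) :
  F_mono ab F m -> C Z -> exists g : Y ~> Z, g \oc m = f.
Proof.
rewrite C_perp => -[mono_m [Q [q [coker_q FQ]]]] perpZ.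
exact: (extend_along_mono f mono_m coker_q (perpZ Q FQ)).
Qed.

(** The colimit under [X] of copies of [c] is an [F]-monomorphism, along which [c]
    itself extends. *)
Lemma special_preenvelope_directed_cocones (X Y : K) (c : X ~> Y) :
  cocomplete K -> strongly_closed_under_directed_colimits ab F ->
  special_preenvelope ab F C c ->
  directed_cocones (Under c : under X).
Proof.
move=> Kcoc Fdir [CY mono_c coker_c] P d d1 dM.
pose D : functor (directed_category P) (under X) :=
  @Functor (directed_category P) (under X) (fun=> Under c) (fun p q _ => d p q)
    d1 (fun p q r qr pq => esym (dM p q r pq qr)).
have [U [l lcol]] := under_directed_colimit_exists D Kcoc.
have U_Fmono := Fdir X P D U l lcol (fun=> conj mono_c coker_c).
have [g gU] := F_mono_extend c U_Fmono CY.
exists (fun p => (exist _ g gU : U ~> (Under c : under X)) \oc leg l p) => p q pq.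
by rewrite -compcA (leg_natural l (pq : hom (p : directed_category P) q)).
Qed.

End Envelopes.

Theorem corollary3p10 (K : category) (ab : isAbelian K) (F C : set K)
    (lpK : locally_presentable K)
    (cotFC : complete_cotorsion_theory ab F C)
    (dirF : strongly_closed_under_directed_colimits ab F) :
  stably_weakly_reflective C.
Proof.
move=> X; case: lpK => Kcoc _; case: cotFC => -[C_perp _] _ /(_ X)[Y [c c_pre]].
have [CY mono_c coker_c] := c_pre.
have [e [ee e_stable]] := stable_idempotent
  (special_preenvelope_directed_cocones C_perp Kcoc dirF c_pre).
have [Z [a [b [abE ba]]]] := idempotent_splits ab (congr1 sval ee).
have ec : sval e \oc c = c by exact: svalP e.
exists Z, (b \oc c); split.
- by move: CY; rewrite C_perp; apply: right_perp_retract ba.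
- move=> W f CW.
  have [g gc] := F_mono_extend C_perp f (conj mono_c coker_c) CW.
  by exists (g \oc a); rewrite -compcA [a \oc _]compcA abE ec.
- move=> h hc.
  (* Apply stability of [e] to the endomorphism [a k b] of [c] under [X]: it gives
     [l] with [l (a k b) e = e], and [b l a] is a left inverse of [k]. *)
  have left_inv (k : Z ~> Z) : k \oc (b \oc c) = b \oc c ->
      exists l : Z ~> Z, l \oc (b \oc c) = b \oc c /\ l \oc k = idc Z.
    move=> kc.
    have kU : (a \oc k \oc b) \oc c = c by rewrite -2!compcA kc compcA abE ec.
    pose x : (Under c : under X) ~> Under c := exist _ (a \oc k \oc b) kU.
    have [l /(congr1 sval) /= lE] := e_stable x.
    exists (b \oc sval l \oc a); split.
      have lc : sval l \oc c = c by exact: svalP l.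
      by rewrite -2!compcA [a \oc _]compcA abE ec lc.
    transitivity (b \oc (sval l \oc (a \oc k \oc b) \oc sval e) \oc a).
      by rewrite -abE -!compcA ba compc1 ba compc1.
    by rewrite lE -abE -compcA -compcA ba compc1.
  have [l [lc lh]] := left_inv h hc; have [k [_ kl]] := left_inv l lc.
  have hl : h \oc l = idc Z.
    by rewrite -[h \oc l]comp1c -kl -compcA [l \oc (h \oc l)]compcA lh comp1c.
  by exists l.
Qed.
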